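(* Let $\mathfrak{g}$ be a finite-dimensional complex simple Lie algebra and let $\mathfrak{p}$ be a parabolic subalgebra of $\mathfrak{g}$. Then $\mathfrak{p}$ is a Borel subalgebra of $\mathfrak{g}$ if and only if, for every finite-dimensional linear representation $\psi:\mathfrak{p}\to\mathfrak{gl}(V)$ and a basis $(\upsilon_1,\dots,\upsilon_m)$ of $\mathfrak{p}$, the characteristic polynomial $\det\big(z_0I+\sum_{i=1}^m z_i\psi(\upsilon_i)\big)\in\mathbb{C}[z_0,\dots,z_m]$ is a product of linear factors.
   Context: A parabolic subalgebra of $\mathfrak{g}$ is a subalgebra containing a Borel subalgebra (a maximal solvable subalgebra) of $\mathfrak{g}$. *)

(* Defs.v *)
From HB Require Import structures.
From mathcomp Require Import all_boot all_order all_algebra.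
From mathcomp Require Import complex Rstruct.
From mathcomp Require Import mpoly.
Set Implicit Arguments. Unset Strict Implicit. Unset Printing Implicit Defensive.
Import GRing.Theory.
Local Open Scope ring_scope.

Definition C : numClosedFieldType := (Rdefinitions.R)[i].

Section Lie.
Variable n : nat.
(* An n-dimensional complex Lie algebra is C^n = 'rV[C]_n with a bracket [br]. *)
Variable br : 'rV[C]_n -> 'rV[C]_n -> 'rV[C]_n.

Definition is_lie_bracket : Prop :=
  [/\ (forall (a : C) x y z, br (a *: x + y) z = a *: br x z + br y z),
      (forall (a : C) x y z, br z (a *: x + y) = a *: br z x + br z y),
      (forall x, br x x = 0) &
      (forall x y z, br x (br y z) + br y (br z x) + br z (br x y) = 0)].

(* Subspaces of g are represented by row spaces of square matrices (mxalgebra). *)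
Definition subalgebra (S : 'M[C]_n) : Prop :=
  forall x y, (x <= S)%MS -> (y <= S)%MS -> (br x y <= S)%MS.

Definition lie_ideal (I : 'M[C]_n) : Prop :=
  forall x y, (y <= I)%MS -> (br x y <= I)%MS.

Definition simple_lie : Prop :=
  (exists x y, br x y != 0) /\
  forall I, lie_ideal I -> (I == (0 : 'M[C]_n))%MS \/ (I == 1%:M)%MS.

(* derived algebra [S,S]: span of brackets of spanning vectors (rows) of S;
   by bilinearity this is the span of all [x,y] with x,y in S. *)
Definition derived (S : 'M[C]_n) : 'M[C]_n :=
  (\sum_(i < n) \sum_(j < n) <<br (row i S) (row j S)>>)%MS.

Definition solvable_sub (S : 'M[C]_n) : Prop :=
  exists k, (iter k derived S == (0 : 'M[C]_n))%MS.

Definition borel (B : 'M[C]_n) : Prop :=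
  [/\ subalgebra B, solvable_sub B &
      forall T, subalgebra T -> solvable_sub T -> (B <= T)%MS -> (T <= B)%MS].

Definition parabolic (P : 'M[C]_n) : Prop :=
  subalgebra P /\ exists B, borel B /\ (B <= P)%MS.

(* A finite-dimensional representation of the subalgebra P on V = C^d:
   a map psi, linear on P, with psi [x,y] = psi x psi y - psi y psi x on P.
   (Values of psi outside P are irrelevant.) *)
Definition is_rep (P : 'M[C]_n) (d : nat) (psi : 'rV[C]_n -> 'M[C]_d) : Prop :=
  (forall (a : C) x y, (x <= P)%MS -> (y <= P)%MS ->
      psi (a *: x + y) = a *: psi x + psi y) /\
  (forall x y, (x <= P)%MS -> (y <= P)%MS ->
      psi (br x y) = psi x *m psi y - psi y *m psi x).

End Lie.

Definition is_basis n (P : 'M[C]_n) m (v : 'I_m -> 'rV[C]_n) : Prop :=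
  let V := \matrix_(i < m) v i in row_free V /\ (V == P)%MS.

(* det(z_0 I + sum_i z_{i} psi(v_i)) in C[z_0, ..., z_m]; variable z_0 is 'X_ord0,
   z_i (1 <= i <= m) is 'X_(lift ord0 (i-1)). *)
Definition char_poly_mv n d m (psi : 'rV[C]_n -> 'M[C]_d) (v : 'I_m -> 'rV[C]_n)
  : {mpoly C[m.+1]} :=
  \det ('X_ord0 *: (1%:M : 'M[{mpoly C[m.+1]}]_d)
        + \sum_(i < m) 'X_(lift ord0 i) *: map_mx (fun c : C => c%:MP) (psi (v i))).

Definition prod_linear_factors k (p : {mpoly C[k]}) : Prop :=
  exists s : seq {mpoly C[k]}, all (fun l => msize l <= 2)%N s /\ p = \prod_(l <- s) l.

(* Main.v *)
Require Import Defs.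
From HB Require Import structures.
From mathcomp Require Import all_boot all_order all_algebra.
From mathcomp Require Import complex Rstruct.
From mathcomp Require Import mpoly.
Set Implicit Arguments. Unset Strict Implicit. Unset Printing Implicit Defensive.
Import Order.TTheory GRing.Theory Num.Theory.
Local Open Scope ring_scope.

(* A Borel subalgebra is solvable, so by Lie's theorem psi is triangular in some
   basis and the determinant is the product of its diagonal entries, which are
   linear forms.  Conversely, a parabolic subalgebra P is Borel as soon as it is
   solvable.  If the characteristic polynomial of the adjoint action of P splits,
   there are linear forms lam_i on P such that ad x has eigenvalues lam_i x.
   Differentiating tr (ad (x + t [a, x]))^k = sum_i lam_i (x + t [a, x])^k at t = 0
   gives sum_i lam_i(x)^(k-1) lam_i([a, x]) = 0 for all k, and separating the distinct
   weights yields lam_i([a, x]) = 0.  Hence [P, P] acts nilpotently, and a subalgebra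
   acting nilpotently is solvable: it is exhausted by solvable subalgebras, each
   normalized by the next one-dimensional extension.  The same vanishing of weights
   on commutators is the invariance step in the proof of Lie's theorem. *)

(** * Linear maps on a row space and traces of powers *)

Definition linear_on (F : fieldType) (m n : nat) (V : lmodType F)
    (K : 'M[F]_(m, n)) (f : 'rV[F]_n -> V) : Prop :=
  forall (a : F) x y, (x <= K)%MS -> (y <= K)%MS ->
    f (a *: x + y) = a *: f x + f y.

Section LinearOn.
Variables (F : fieldType) (m n : nat) (V : lmodType F).
Implicit Types (K : 'M[F]_(m, n)) (f : 'rV[F]_n -> V).

Lemma linear_on0 K f : linear_on K f -> f 0 = 0.
Proof.
move=> fL; have := fL 1 0 0 (sub0mx _ _) (sub0mx _ _).
by rewrite !scale1r addr0 => /eqP; rewrite -subr_eq subrr eq_sym => /eqP.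
Qed.

Lemma linear_onD K f x y : linear_on K f -> (x <= K)%MS -> (y <= K)%MS ->
  f (x + y) = f x + f y.
Proof. by move=> fL xK yK; have := fL 1 _ _ xK yK; rewrite !scale1r. Qed.

Lemma linear_onZ K f a x : linear_on K f -> (x <= K)%MS -> f (a *: x) = a *: f x.
Proof.
move=> fL xK; have := fL a _ _ xK (sub0mx _ _).
by rewrite (linear_on0 fL) !addr0.
Qed.

Lemma linear_on_mulmx K f (u : 'rV[F]_m) : linear_on K f ->
  f (u *m K) = \sum_j u 0 j *: f (row j K).
Proof.
move=> fL; rewrite mulmx_sum_row.
suff [//] : f (\sum_j u 0 j *: row j K) = \sum_j u 0 j *: f (row j K) /\
     ((\sum_j u 0 j *: row j K)%R <= K)%MS.
apply: (big_rec2 (fun x y => f x = y /\ (x <= K)%MS)).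
  by rewrite (linear_on0 fL) sub0mx.
move=> j y x _ [<- xK]; split; first by rewrite fL // row_sub.
by rewrite addmx_sub // scalemx_sub // row_sub.
Qed.

Lemma linear_onS p K (K' : 'M[F]_(p, n)) f : (K <= K')%MS -> linear_on K' f -> linear_on K f.
Proof.
by move=> sK fL a x y xK yK; rewrite fL //; apply: submx_trans sK.
Qed.

End LinearOn.

Lemma char_poly_conj (F : fieldType) d (P M : 'M[F]_d) : P \in unitmx ->
  char_poly (P *m M *m invmx P) = char_poly M.
Proof.
move=> Pu; rewrite /char_poly /char_poly_mx.
have -> : 'X%:M - map_mx polyC (P *m M *m invmx P) =
   map_mx polyC P *m ('X%:M - map_mx polyC M) *m map_mx polyC (invmx P).
  rewrite mulmxBr mulmxBl -!map_mxM; congr (_ - _).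
  by rewrite scalar_mxC -mulmxA -map_mxM mulmxV // map_mx1 mulmx1.
rewrite !det_mulmx mulrC mulrA -det_mulmx -map_mxM mulVmx //.
by rewrite map_mx1 det1 mul1r.
Qed.

Lemma mxtrace_exp_trig (R : comNzRingType) d (T : 'M[R]_d) k : is_trig_mx T ->
  \tr (T ^+ k) = \sum_i T i i ^+ k.
Proof.
move=> /is_trig_mxP Tt.
suff H : forall i j : 'I_d, (i <= j)%N -> (T ^+ k) i j = (T i i ^+ k) *+ (i == j).
  by apply: eq_bigr => i _; rewrite H // eqxx.
elim: k => [|k IH] i j le_ij; first by rewrite expr0 mxE.
rewrite exprS -[_ * _]/(_ *m _) mxE (bigD1 i) //= IH // big1 ?addr0.
  by rewrite mulrnAr exprS.
move=> l l_neq_i; case: (ltnP i l) => [lt_il|le_li]; first by rewrite Tt ?mul0r.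
have lt_li : (l < i)%N by rewrite ltn_neqAle le_li andbT.
rewrite IH; last exact: ltnW (leq_trans lt_li le_ij).
case: eqP => [e|_]; last by rewrite mulr0.
by move: (leq_trans lt_li le_ij); rewrite e ltnn.
Qed.

Lemma mxtrace_exp_conj (F : fieldType) d (P M : 'M[F]_d) k : P \in unitmx ->
  \tr ((P *m M *m invmx P) ^+ k) = \tr (M ^+ k).
Proof.
move=> Pu; suff -> : (P *m M *m invmx P) ^+ k = P *m M ^+ k *m invmx P.
  by rewrite mxtrace_mulC mulmxA mulVmx // mul1mx.
elim: k => [|k IH]; first by rewrite !expr0 mulmx1 mulmxV.
by rewrite !exprS IH -![_ * _]/(_ *m _) !mulmxA mulmxKV.
Qed.

(** * Power sums of eigenvalues and common non-zeros of functionals *)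

Section ClosedField.
Variable F : numClosedFieldType.

(** By Schur triangularization [M] is similar to a triangular matrix, whose diagonal is a
    permutation of the family [e] because both list the roots of one split polynomial. *)
Lemma mxtrace_exp_roots (I : Type) (r : seq I) (e : I -> F) d (M : 'M[F]_d) k :
  char_poly M = \prod_(i <- r) ('X - (e i)%:P) ->
  \tr (M ^+ k) = \sum_(i <- r) e i ^+ k.
Proof.
have [P Pu Pt] : exists2 P, P \in unitmx & is_trig_mx (P *m M *m invmx P).
  have [d0|] := posnP d.
    by subst d; exists 1%:M; [exact: unitmx1 | apply/is_trig_mxP => -[]].
  case/(Schur M) => P /unitarymx_unit Pu Pt; exists P => //.
  by rewrite -conjumx.
rewrite -(mxtrace_exp_conj M k Pu) -(char_poly_conj M Pu) (mxtrace_exp_trig _ Pt).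
rewrite (char_poly_trig Pt); set T := _ *m invmx P.
rewrite -(big_map e xpredT (fun z => 'X - z%:P)) -(big_map e xpredT (fun z => z ^+ k)).
rewrite -(big_map (fun i => T i i) xpredT (fun z => 'X - z%:P)).
rewrite -(big_map (fun i => T i i) xpredT (fun z => z ^+ k)).
by move=> /prod_XsubC_eq pe; apply: perm_big.
Qed.

Lemma poly_nonroot (p : {poly F}) : p != 0 -> exists t, p.[t] != 0.
Proof.
move=> p0; have uniq_nat m : uniq [seq i%:R : F | i <- iota 0 m].
  by rewrite map_inj_uniq ?iota_uniq // => i j /eqP; rewrite eqr_nat => /eqP.
case: (boolP (all (root p) [seq i%:R : F | i <- iota 0 (size p)])) => [ar|].
  by have := max_poly_roots p0 ar (uniq_nat _); rewrite size_map size_iota ltnn.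
by case/allPn=> t _ rt; exists t.
Qed.

Lemma poly_horner_inj (p q : {poly F}) : (forall t, p.[t] = q.[t]) -> p = q.
Proof.
move=> pq; apply/eqP; rewrite -subr_eq0; apply/negPn/negP => /poly_nonroot [t].
by rewrite hornerD hornerN pq subrr eqxx.
Qed.

(* Evaluate on the moment curve (1, t, t^2, ...). *)
Lemma nonzero_functionals_common_nonzero n (I : Type) (r : seq I)
    (P : pred I) (c : I -> 'cV[F]_n) :
  (forall i, P i -> c i != 0) ->
  exists u : 'rV[F]_n, \prod_(i <- r | P i) (u *m c i) 0 0 != 0.
Proof.
move=> c0; pose q i := rVpoly (c i)^T.
have [t] : exists t, (\prod_(i <- r | P i) q i).[t] != 0.
  apply: poly_nonroot; apply: (big_ind (fun p => p != 0)).
  - exact: oner_neq0.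
  - by move=> p1 p2 p10 p20; rewrite mulf_neq0.
  move=> i Pi; apply: contra_neq (c0 i Pi) => qi0.
  by rewrite -[c i]trmxK -[(c i)^T]rVpolyK -/(q i) qi0 linear0 trmx0.
rewrite horner_prod => nz; exists (\row_j t ^+ j).
congr (_ != 0): nz; apply: eq_bigr => i _.
rewrite horner_poly mxE; apply: eq_bigr => j _.
by rewrite !mxE insubT //= => lt; rewrite mulrC mxE; congr (_ * c i _ _); apply: val_inj.
Qed.

End ClosedField.

(** * Weights vanish on commutators *)

Lemma map_mx_exp (R S : nzRingType) (f : {rmorphism R -> S}) d (M : 'M[R]_d) k :
  map_mx f (M ^+ k) = map_mx f M ^+ k.
Proof.
elim: k => [|k IH]; first by rewrite !expr0 map_mx1.
by rewrite !exprS -IH; exact: map_mxM.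
Qed.

Lemma map_mx_derivM (R : nzRingType) d (M N : 'M[{poly R}]_d) :
  map_mx (@deriv R) (M *m N) = map_mx (@deriv R) M *m N + M *m map_mx (@deriv R) N.
Proof.
apply/matrixP=> i j; rewrite !mxE raddf_sum -big_split; apply: eq_bigr => l _ /=.
by rewrite !mxE derivM.
Qed.

(** [M] need not commute with its derivative, but cyclicity of the trace brings the derivative to
    the end of each term; the factor [M ^+ j] is carried for the induction. *)
Lemma mxtrace_mul_deriv_exp (R : comNzRingType) d (M : 'M[{poly R}]_d) j k :
  \tr (M ^+ j *m map_mx (@deriv R) (M ^+ k.+1))
    = k.+1%:R * \tr (M ^+ (j + k) *m map_mx (@deriv R) M).
Proof.
elim: k j => [|k IH] j; first by rewrite addn0 mul1r expr1.
rewrite exprSr -[_ * _]/(_ *m _) map_mx_derivM mulmxDr mxtraceD !mulmxA.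
rewrite mxtrace_mulC mulmxA -[M *m _]/(M * _) -exprS IH addSnnS.
rewrite -[M ^+ j *m _]/(_ * _) -exprD -[X in _ + X]mul1r -mulrDl.
by rewrite -[k.+2%:R]natr1.
Qed.

Lemma deriv_mxtrace_exp_line (R : comNzRingType) d (X Y : 'M[R]_d) k :
  (\tr ((map_mx polyC X + 'X *: map_mx polyC Y) ^+ k.+1))^`().[0]
    = k.+1%:R * \tr (X ^+ k *m Y).
Proof.
set M := _ + _.
have M0 : map_mx (horner_eval 0) M = X.
  by apply/matrixP => i j; rewrite !mxE /horner_eval !hornerE.
have dM : map_mx (@deriv R) M = map_mx polyC Y.
  by apply/matrixP => i j; rewrite !mxE derivD derivM derivX !derivC mulr0 addr0 mul1r add0r.
have -> : (\tr (M ^+ k.+1))^`() = \tr (map_mx (@deriv R) (M ^+ k.+1)).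
  by rewrite raddf_sum; apply: eq_bigr => i _; rewrite mxE.
have := mxtrace_mul_deriv_exp M 0 k; rewrite expr0 mul1mx add0n dM => ->.
rewrite !mulr_natl hornerMn; congr (_ *+ _).
rewrite -[LHS]/(horner_eval 0 _) -trace_map_mx map_mxM map_mx_exp M0.
congr (\tr (_ *m _)); apply/matrixP => i j.
by rewrite !mxE; exact: hornerC.
Qed.

Section Weights.
Variables (F : numClosedFieldType) (n d : nat) (K : 'M[F]_n).
Variables (psi : 'rV[F]_n -> 'M[F]_d) (D : 'rV[F]_n -> 'rV[F]_n) (A : 'M[F]_d).
Variables (I : eqType) (r : seq I) (lam : I -> 'rV[F]_n -> F).
Hypothesis psi_lin : linear_on K psi.
Hypothesis D_lin : linear_on K D.
Hypothesis D_stable : forall x, (x <= K)%MS -> (D x <= K)%MS.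
Hypothesis psi_D : forall x, (x <= K)%MS -> psi (D x) = A *m psi x - psi x *m A.
Hypothesis lam_lin : forall i, linear_on K (lam i : _ -> F^o).
Hypothesis psi_char : forall x, (x <= K)%MS ->
  char_poly (psi x) = \prod_(i <- r) ('X - (lam i x)%:P).

(* Differentiate tr (psi (x + t D x) ^ k) = sum_i lam_i (x + t D x) ^ k at t = 0;
   the left-hand derivative is the trace of a commutator. *)
Lemma sum_weight_pow x k : (x <= K)%MS ->
  \sum_(i <- r) lam i x ^+ k * lam i (D x) = 0.
Proof.
move=> xK; have DxK := D_stable xK.
pose p := \sum_(i <- r) ((lam i x)%:P + lam i (D x) *: 'X) ^+ k.+1.
have dp : p^`().[0] = k.+1%:R * \sum_(i <- r) lam i x ^+ k * lam i (D x).
  rewrite raddf_sum horner_sum mulr_sumr; apply: eq_bigr => i _ /=.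
  rewrite deriv_exp derivD derivC derivZ derivX add0r hornerMn mulr_natl.
  by congr (_ *+ _); rewrite hornerM horner_exp !hornerE mulrC.
(* Both sides agree at every scalar t because x + t D x stays in [K]; hence they agree as
   polynomials. *)
have : p = \tr ((map_mx polyC (psi x) + 'X *: map_mx polyC (psi (D x))) ^+ k.+1).
  apply: poly_horner_inj => t.
  rewrite -[RHS]/(horner_eval t _) -trace_map_mx map_mx_exp.
  have -> : map_mx (horner_eval t) (map_mx polyC (psi x) + 'X *: map_mx polyC (psi (D x)))
     = psi (t *: D x + x).
    rewrite psi_lin //; apply/matrixP => i j.
    by rewrite !mxE /horner_eval !hornerE addrC.
  rewrite (mxtrace_exp_roots _ (psi_char _)); last by rewrite addmx_sub ?scalemx_sub.
  rewrite horner_sum; apply: eq_bigr => i _.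
  by rewrite horner_exp !hornerE lam_lin // addrC -[t *: _]/(t * _) mulrC.
move=> /(congr1 (fun q => q^`().[0])); rewrite dp deriv_mxtrace_exp_line psi_D //.
move=> e; apply: (mulfI (_ : k.+1%:R != 0)); first by rewrite pnatr_eq0.
rewrite e mulr0; suff -> : \tr (psi x ^+ k *m (A *m psi x - psi x *m A)) = 0.
  by rewrite mulr0.
rewrite mulmxBr raddfB /= !mulmxA mxtrace_mulC mulmxA -[psi x *m _]/(_ * _).
by rewrite -[psi x ^+ k *m psi x]/(_ * _) -exprS -exprSr subrr.
Qed.

Lemma sum_weight_poly x (p : {poly F}) : (x <= K)%MS ->
  \sum_(i <- r) p.[lam i x] * lam i (D x) = 0.
Proof.
move=> xK; under eq_bigr => i _ do rewrite horner_coef mulr_suml.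
rewrite exchange_big /= big1 // => j _.
under eq_bigr => i _ do rewrite -mulrA.
by rewrite -mulr_sumr sum_weight_pow // mulr0.
Qed.

(* Taking p = prod_(lam_j <> lam_i) ('X - lam_j x) isolates the multiple of
   lam_i (D x) * prod_(lam_j <> lam_i) (lam_i x - lam_j x), a product of linear forms. *)
Lemma weight_derivation_eq0 i x : i \in r -> (x <= K)%MS -> lam i (D x) = 0.
Proof.
move=> ir xK; pose c j : 'cV[F]_n := \col_l lam j (row l K).
have cE j u : lam j (u *m K) = (u *m c j) 0 0.
  rewrite (linear_on_mulmx u (lam_lin j)) mxE; apply: eq_bigr => l _.
  by rewrite mxE.
pose e : 'cV[F]_n := \col_l lam i (D (row l K)).
have eE u : lam i (D (u *m K)) = (u *m e) 0 0.
  rewrite (@linear_on_mulmx _ _ _ _ K (fun z => lam i (D z) : F^o)).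
    by rewrite mxE; apply: eq_bigr => l _; rewrite mxE.
  by move=> a y z yK zK; rewrite D_lin // lam_lin ?D_stable.
suff e0 : e = 0 by case/submxP: xK => u ->; rewrite eE e0 mulmx0 mxE.
apply/eqP/negPn/negP => e_neq0.
(* [None] stands for the functional lam_i o D and [Some j] for a difference of distinct weights;
   some [u] makes all of them nonzero. *)
pose Q := [pred o : option I | if o is Some j then c j != c i else true].
pose g (o : option I) := if o is Some j then c i - c j else e.
have [|u] := nonzero_functionals_common_nonzero (None :: map Some r) (P := Q) (c := g).
  by case=> [j|] //= cj; rewrite subr_eq0 eq_sym.
rewrite big_cons /= big_map mulf_eq0 negb_or => /andP[eu pu].
pose p := \prod_(j <- r | c j != c i) ('X - (lam j (u *m K))%:P).
have := sum_weight_poly p (submxMl u K).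
rewrite (bigID (fun j => c j == c i)) /= [X in _ + X]big1_seq ?addr0; last first.
  move=> j /andP[cj jr]; rewrite (_ : p.[_] = 0) ?mul0r //.
  apply/rootP; rewrite /p (big_rem j) //= cj rootM root_XsubC eqxx //.
rewrite (eq_bigr (fun=> p.[lam i (u *m K)] * lam i (D (u *m K)))); last first.
  move=> j /eqP cj; have /submxP[w ->] := D_stable (submxMl u K).
  by rewrite !cE cj.
(* The surviving terms are all equal; their number is positive, hence nonzero in characteristic
   zero. *)
rewrite big_const_seq iter_addr_0 => /eqP; rewrite mulrn_eq0 mulf_eq0 eE.
rewrite (negPf eu) orbF -leqn0 leqNgt -has_count.
rewrite (_ : has _ r) /=; last by apply/hasP; exists i; rewrite /=.
apply/negP; rewrite /p horner_prod; congr (_ != 0): pu.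
by apply: eq_bigr => j _; rewrite !hornerE !cE mulmxBr [in LHS]mxE [X in _ + X]mxE.
Qed.

End Weights.

(** * Lie's theorem *)

Section Quotient.
Variables (F : fieldType) (d : nat).
Implicit Types (A M N : 'M[F]_d.+1) (B : 'M[F]_d).

(** In the decomposition of v as [col_ebase v *m pid_mx 1 *m row_ebase v] the left factor is an
    invertible scalar, so the first row of [row_ebase v] spans the line of v. *)
Lemma complete_row (v : 'rV[F]_d.+1) : v != 0 ->
  exists2 A : 'M[F]_d.+1, A \in unitmx & (row 0 A :=: v)%MS.
Proof.
move=> v0; exists (row_ebase v); first exact: row_ebase_unit.
have rv : \rank v = 1%N by apply/eqP; rewrite rank_rV v0.
have := mulmx_ebase v; rewrite rv -mulmxA.
have -> : pid_mx 1 *m row_ebase v = row 0 (row_ebase v).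
  rewrite rowE; congr (_ *m _); apply/matrixP => i j.
  by rewrite !mxE !ord1 eqxx /= andbT eq_sym.
by move=> {2}<-; apply: eqmx_sym; apply: eqmxMfull; rewrite row_full_unit col_ebase_unit.
Qed.

Definition conj1_mx A M : 'M[F]_(1 + d) := A *m M *m invmx A.

(* The matrix of M on the quotient by the line spanned by the first row of A. *)
Definition quotient_mx A M : 'M[F]_d := drsubmx (conj1_mx A M).

Definition ext1_mx B : 'M[F]_(1 + d) := block_mx 1%:M 0 0 B.

Lemma quotient_mxP A a M N :
  quotient_mx A (a *: M + N) = a *: quotient_mx A M + quotient_mx A N.
Proof.
rewrite /quotient_mx /conj1_mx mulmxDr mulmxDl -scalemxAr -scalemxAl.
by apply/matrixP => i j; rewrite !mxE.
Qed.

Lemma quotient_mxB A M N : quotient_mx A (M - N) = quotient_mx A M - quotient_mx A N.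
Proof. by rewrite addrC -scaleN1r quotient_mxP scaleN1r addrC. Qed.

Lemma ursubmx_conj1 A M : A \in unitmx -> (row 0 A *m M <= row 0 A)%MS ->
  ursubmx (conj1_mx A M) = 0.
Proof.
move=> Au /sub_rVP[a ea]; apply/matrixP => i j; rewrite !mxE.
rewrite -[LHS]/(\sum_j0 (A *m M) (lshift d i) j0 * invmx A j0 (rshift 1 j)).
have -> : lshift d i = 0 by apply: val_inj; rewrite /= ord1.
transitivity ((row 0 A *m M *m invmx A) 0 (rshift 1 j)).
  by rewrite -row_mul mxE; apply: eq_bigr => l _; rewrite [in RHS]mxE.
by rewrite ea -scalemxAl -row_mul mulmxV // !mxE mulr0.
Qed.

(** In a basis starting with the stable line of [N], the upper right block of [N] is zero, so lower
    right blocks multiply. *)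
Lemma quotient_mxM A M N : A \in unitmx -> (row 0 A *m N <= row 0 A)%MS ->
  quotient_mx A (M *m N) = quotient_mx A M *m quotient_mx A N.
Proof.
move=> Au AN; have N0 := ursubmx_conj1 Au AN.
have e : conj1_mx A (M *m N) = conj1_mx A M *m conj1_mx A N.
  by rewrite /conj1_mx !mulmxA mulmxKV.
rewrite /quotient_mx e -{1}[conj1_mx A M]submxK -{1}[conj1_mx A N]submxK.
by rewrite mulmx_block block_mxKdr N0 mulmx0 add0r.
Qed.

Lemma quotient_mx_comm A M N : A \in unitmx ->
  (row 0 A *m M <= row 0 A)%MS -> (row 0 A *m N <= row 0 A)%MS ->
  quotient_mx A (M *m N - N *m M)
    = quotient_mx A M *m quotient_mx A N - quotient_mx A N *m quotient_mx A M.
Proof. by move=> Au AM AN; rewrite quotient_mxB !quotient_mxM. Qed.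

Lemma ext1_mx_unit B : (ext1_mx B \in unitmx) = (B \in unitmx).
Proof. by rewrite unitmxE det_ublock det1 mul1r -unitmxE. Qed.

(** [A] splits off the stable line and [B] triangularizes the quotient; [T1] is the resulting block
    triangular matrix. *)
Lemma is_trig_ext1 A B M : A \in unitmx -> B \in unitmx ->
  (row 0 A *m M <= row 0 A)%MS -> is_trig_mx (B *m quotient_mx A M *m invmx B) ->
  is_trig_mx ((ext1_mx B *m A) *m M *m invmx (ext1_mx B *m A)).
Proof.
move=> Au Bu AM; set T := _ *m invmx B => Tt; set E := ext1_mx B.
have Eu : E *m A \in unitmx by rewrite unitmx_mul ext1_mx_unit Bu.
set Q := conj1_mx A M.
pose T1 : 'M[F]_(1 + d) := block_mx (ulsubmx Q) 0 (B *m dlsubmx Q) T.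
have T1t : is_trig_mx T1 by rewrite is_trig_block_mx // eqxx Tt mx11_is_trig.
suff -> : E *m A *m M = T1 *m (E *m A) by rewrite mulmxK.
have -> : E *m A *m M = E *m Q *m A by rewrite /Q /conj1_mx !mulmxA mulmxKV.
rewrite mulmxA; congr (_ *m _).
rewrite -[Q]submxK ursubmx_conj1 // /E /ext1_mx /T1 !mulmx_block.
by rewrite !(mul1mx, mulmx1, mul0mx, mulmx0, addr0, add0r) mulmxKV.
Qed.

End Quotient.

Lemma eigenvector_in_stable (F : numClosedFieldType) d (W M : 'M[F]_d) : W != 0 -> (W *m M <= W)%MS ->
  exists2 v : 'rV[F]_d, v != 0 /\ (v <= W)%MS & (v *m M <= v)%MS.
Proof.
move=> W0 WM; have [|a /eigenvalueP[v va v0]] := eigenvalue_closed (restrictmx W M).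
  by rewrite lt0n mxrank_eq0.
exists (v *m row_base W).
  by rewrite mulmx_free_eq0 ?row_base_free // mulmx_sub // eq_row_base.
have e : restrictmx W M *m row_base W = row_base W *m M.
  by rewrite /conjmx mulmxKpV // stablemx_row_base.
by rewrite -mulmxA -e mulmxA va -scalemxAl scalemx_sub.
Qed.

(** * Derived series and simultaneous triangularization *)

Section LieAlgebra.
Variables (n : nat) (br : 'rV[C]_n -> 'rV[C]_n -> 'rV[C]_n).
Hypothesis hlie : is_lie_bracket br.

Lemma br_linear_l m (K : 'M[C]_(m, n)) y : linear_on K (br^~ y).
Proof. by case: hlie => brl _ _ _ a x z _ _; rewrite brl. Qed.

Lemma br_linear_r m (K : 'M[C]_(m, n)) x : linear_on K (br x).
Proof. by case: hlie => _ brr _ _ a y z _ _; rewrite brr. Qed.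

Lemma brC x y : br x y = - br y x.
Proof.
case: hlie => _ _ brxx _; have := brxx (x + y).
rewrite (linear_onD (br_linear_l (K := (1%:M : 'M[C]_n)) _)) ?submx1 //.
rewrite !(linear_onD (br_linear_r (K := (1%:M : 'M[C]_n)) _)) ?submx1 // !brxx add0r addr0.
by move=> /eqP; rewrite addr_eq0 => /eqP.
Qed.

Lemma br_derived S x y : (x <= S)%MS -> (y <= S)%MS -> (br x y <= derived br S)%MS.
Proof.
move=> /submxP[u ->] /submxP[w ->].
rewrite (linear_on_mulmx u (br_linear_l (K := S) _)); apply: summx_sub => i _.
rewrite (linear_on_mulmx w (br_linear_r (K := S) _)); apply: scalemx_sub.
apply: summx_sub => j _; apply: scalemx_sub.
by rewrite (sumsmx_sup i) // (sumsmx_sup j) // genmxE.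
Qed.

Lemma derived_sub (S U : 'M[C]_n) :
  (forall x y, (x <= S)%MS -> (y <= S)%MS -> (br x y <= U)%MS) ->
  (derived br S <= U)%MS.
Proof.
move=> brU; apply/sumsmx_subP => i _; apply/sumsmx_subP => j _.
by rewrite genmxE brU ?row_sub.
Qed.

Lemma derivedS S T : (S <= T)%MS -> (derived br S <= derived br T)%MS.
Proof.
by move=> sST; apply: derived_sub => x y xS yS; apply: br_derived; apply: submx_trans sST.
Qed.

Lemma derived_subalgebra S : subalgebra br S -> (derived br S <= S)%MS.
Proof. exact: derived_sub. Qed.

Lemma subalgebra_derived S : subalgebra br S -> subalgebra br (derived br S).
Proof.
move=> Ssub x y xS yS.
by apply: br_derived; apply: submx_trans (derived_subalgebra Ssub).
Qed.

Lemma solvable_subS S T : (S <= T)%MS -> solvable_sub br T -> solvable_sub br S.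
Proof.
move=> sST [k /eqmx0P Tk0]; exists k.
have sk : (iter k (derived br) S <= iter k (derived br) T)%MS.
  by elim: k {Tk0} => //= k IH; apply: derivedS.
by move: sk; rewrite Tk0 submx0 => /eqP ->; rewrite eqxx sub0mx.
Qed.

Lemma solvable_derived S : solvable_sub br (derived br S) -> solvable_sub br S.
Proof. by case=> k Sk0; exists k.+1; rewrite iterSr. Qed.

Lemma is_repS (K L : 'M[C]_n) d (psi : 'rV[C]_n -> 'M[C]_d) :
  (K <= L)%MS -> is_rep br L psi -> is_rep br K psi.
Proof.
move=> sKL [pL pB]; split; first exact: linear_onS pL.
by move=> x y xK yK; apply: pB; apply: submx_trans sKL.
Qed.

(** This notion and the next range over all representations, so that triangularization can recurse
    on the quotient of [psi] by an invariant line. *)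
Definition triangularizable (L : 'M[C]_n) : Prop :=
  forall d (psi : 'rV[C]_n -> 'M[C]_d), is_rep br L psi ->
  exists2 A, A \in unitmx &
    forall x, (x <= L)%MS -> is_trig_mx (A *m psi x *m invmx A).

Definition has_common_eigenvectors (L : 'M[C]_n) : Prop :=
  forall d (psi : 'rV[C]_n -> 'M[C]_d.+1), is_rep br L psi ->
  exists2 v : 'rV[C]_d.+1, v != 0 &
    forall x, (x <= L)%MS -> (v *m psi x <= v)%MS.

Lemma triangularizable_eigen L : has_common_eigenvectors L -> triangularizable L.
Proof.
move=> eigL; elim=> [|d IH] psi psiR.
  by exists 1%:M; [exact: unitmx1 | move=> x _; apply/is_trig_mxP => -[]].
have [v v0 vP] := eigL _ _ psiR; have [A Au Av] := complete_row v0.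
have Ast x : (x <= L)%MS -> (row 0 A *m psi x <= row 0 A)%MS.
  by move=> xL; rewrite Av (submx_trans _ (vP x xL)) // submxMr // Av.
have [|B Bu Bt] := IH (fun x => quotient_mx A (psi x)).
  case: psiR => pL pB; split=> [a x y xL yL|x y xL yL].
    by rewrite pL // quotient_mxP.
  by rewrite pB // quotient_mx_comm // Ast.
exists (ext1_mx B *m A); first by rewrite unitmx_mul ext1_mx_unit Bu.
by move=> x xL; apply: is_trig_ext1; rewrite ?Ast ?Bt.
Qed.

(* Lie's theorem, inductive step: the weights of K vanish on [L, K], so the
   weight space of the first vector of a K-stable flag is stable under y. *)
Lemma has_common_eigenvectors_extend K L (y : 'rV[C]_n) :
  (K <= L)%MS -> (y <= L)%MS -> (L <= K + y)%MS ->
  (forall a x, (a <= L)%MS -> (x <= K)%MS -> (br a x <= K)%MS) ->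
  triangularizable K -> has_common_eigenvectors L.
Proof.
move=> sKL yL LKy idK triK d psi psiR; have psiRK := is_repS sKL psiR.
have [A Au At] := triK _ _ psiRK; case: psiR psiRK => pL pB [pLK _].
pose lam i x := (A *m psi x *m invmx A) i i.
have lamL i : linear_on K (lam i : _ -> C^o).
  move=> a x z xK zK; rewrite /lam pLK // mulmxDr mulmxDl -scalemxAr -scalemxAl.
  by rewrite !mxE.
(* Here [br a] is the derivation and [psi a] the matrix implementing it on [K]. *)
have lam0 a x : (a <= L)%MS -> (x <= K)%MS -> lam 0 (br a x) = 0.
  move=> aL xK; apply: (weight_derivation_eq0 (psi := psi) (A := psi a)
      pLK (br_linear_r a) _ _ lamL _ (mem_index_enum _)) => // z zK.
  - exact: idK.
  - by rewrite pB //; apply: submx_trans sKL.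
  by rewrite -(char_poly_conj _ Au) char_poly_trig ?At.
(* Joint eigenspace of weight [lam 0]; conditions on the rows of [K] suffice by linearity. *)
pose W := (\bigcap_(j < n) kermx (psi (row j K) - (lam 0 (row j K))%:M))%MS.
have WP w : (w <= W)%MS <-> forall x, (x <= K)%MS -> w *m psi x = lam 0 x *: w.
  split=> [/sub_bigcapmxP wW x /submxP[u ->]|wK].
    rewrite (linear_on_mulmx u pLK) (linear_on_mulmx u (lamL 0)).
    rewrite mulmx_sumr scaler_suml; apply: eq_bigr => j _.
    have /sub_kermxP := wW j isT; rewrite mulmxBr mul_mx_scalar => /eqP.
    by rewrite subr_eq0 -scalemxAr => /eqP ->; rewrite scalerA.
  apply/sub_bigcapmxP => j _; apply/sub_kermxP.
  by rewrite mulmxBr mul_mx_scalar wK ?subrr ?row_sub.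
(* Lower triangularity makes the first row of [A] a common eigenvector of weight [lam 0]. *)
have W0 : W != 0.
  have : (row 0 A <= W)%MS.
    apply/WP => x xK; have := At x xK => /is_trig_mxP Tt.
    rewrite -row_mul -[A *m psi x](mulmxKV Au) row_mul.
    set r := row 0 _; have -> : r = lam 0 x *: delta_mx 0 0.
      apply/rowP => j; rewrite !mxE eqxx /=; case: eqVneq => [->|j0]; first by rewrite mulr1 /lam mxE.
      by have := Tt 0 j; rewrite mxE mulr0 => -> //; rewrite lt0n.
    by rewrite -scalemxAl -rowE.
  apply: contraTneq => ->; rewrite submx0; apply/negP => /eqP A0.
  have := row_mul 0 A (invmx A); rewrite A0 mul0mx mulmxV // => /rowP/(_ 0).
  by rewrite !mxE => /eqP; rewrite oner_eq0.
(* w psi(y) psi(x) = w psi([y, x]) + w psi(x) psi(y), and the first term has weight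
   [lam 0 (br y x)], which is zero. *)
have WM : (W *m psi y <= W)%MS.
  apply/WP => x xK; have WK := (WP _ W).1 (submx_refl W).
  have e := pB y x yL (submx_trans xK sKL).
  have -> : W *m psi y *m psi x = W *m psi (br y x) + W *m psi x *m psi y.
    by rewrite e mulmxBr !mulmxA subrK.
  by rewrite WK ?idK // lam0 // scale0r add0r WK // scalemxAl.
have [v [v0 vW] vy] := eigenvector_in_stable W0 WM.
exists v => // x xL; have /sub_addsmxP[[u1 u2] /= ex] := submx_trans xL LKy.
have k1 := submxMl u1 K.
rewrite ex (linear_onD pL (mulmx_sub _ sKL) (mulmx_sub _ yL)).
rewrite mulmxDr addmx_sub //; first by rewrite ((WP _ v).1 vW) // scalemx_sub.
by rewrite [u2]mx11_scalar mul_scalar_mx (linear_onZ _ pL) // -scalemxAr scalemx_sub.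
Qed.

(** Induction on the derived length: to the derived algebra the rows of [S] are adjoined one at a
    time. Each intermediate space contains [S, S], so its brackets with the next one fall back into
    it. *)
Lemma triangularizable_solvable S :
  subalgebra br S -> solvable_sub br S -> triangularizable S.
Proof.
move=> Ssub [k]; elim: k S Ssub => [|k IH] S Ssub.
  move=> /eqmx0P /= -> d psi [pL _]; exists 1%:M; first exact: unitmx1.
  move=> x; rewrite submx0 => /eqP ->.
  by rewrite (linear_on0 pL) mulmx0 mul0mx mx0_is_trig.
rewrite iterSr => /(IH _ (subalgebra_derived Ssub)) triD.
pose U (t : seq 'rV[C]_n) := foldr (fun y V => (V + y)%MS) (derived br S) t : 'M[C]_n.
have DU t : (derived br S <= U t)%MS.
  by elim: t => //= y t IHt; apply: submx_trans IHt (addsmxSl _ _).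
have triU t : (forall y, y \in t -> (y <= S)%MS) ->
    (U t <= S)%MS /\ triangularizable (U t).
  elim: t => [|y t IHt] tS /=; first by split; [exact: derived_subalgebra|].
  have [|Ut triUt] := IHt; first by move=> z zt; apply: tS; rewrite inE zt orbT.
  have yS := tS y (mem_head _ _).
  have UyS : (U t + y <= S)%MS by rewrite addsmx_sub Ut.
  split=> //; apply: triangularizable_eigen.
  apply: (has_common_eigenvectors_extend (K := U t) (y := y)) => //.
  - exact: addsmxSl.
  - exact: addsmxSr.
  move=> a x aU xU; apply: submx_trans (DU t); apply: br_derived.
    exact: submx_trans UyS.
  exact: submx_trans Ut.
pose t := [seq row i S | i <- enum 'I_n].
have [|Ut triUt] := triU t; first by move=> y /mapP[i _ ->]; apply: row_sub.
have SU : (S <= U t)%MS.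
  apply/row_subP => i; have : row i S \in t by apply: map_f; rewrite mem_enum.
  elim: t {Ut triUt} => //= y t IHt; rewrite inE => /predU1P[->|/IHt h].
    exact: addsmxSr.
  exact: submx_trans h (addsmxSl _ _).
move=> d psi psiR; have [A Au At] := triUt _ _ (is_repS Ut psiR).
by exists A => // x xS; apply: At; apply: submx_trans SU.
Qed.

End LieAlgebra.

(** * Linear factors of matrix pencils *)

Section Pencils.
Variables (F : fieldType) (S : comNzRingType) (f : {rmorphism F -> S}) (d m : nat).

(** A constant change of basis triangularizes the whole pencil at once, whatever scalars [z0] and
    [z] of [S] are inserted. *)
Lemma det_pencil_trig (z0 : S) (z : 'I_m -> S) (M : 'I_m -> 'M[F]_d) (A : 'M[F]_d) :
  A \in unitmx -> (forall j, is_trig_mx (A *m M j *m invmx A)) ->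
  \det (z0 *: 1%:M + \sum_j z j *: map_mx f (M j)) =
  \prod_i (z0 + \sum_j z j * f ((A *m M j *m invmx A) i i)).
Proof.
move=> Au At; set Z := _ + _.
pose T := z0 *: (1%:M : 'M[S]_d) + \sum_j z j *: map_mx f (A *m M j *m invmx A).
have eT : map_mx f A *m Z *m map_mx f (invmx A) = T.
  rewrite mulmxDr mulmxDl -scalemxAr mulmx1 -scalemxAl -map_mxM mulmxV // map_mx1.
  congr (_ + _); rewrite mulmx_sumr mulmx_suml; apply: eq_bigr => j _.
  by rewrite -scalemxAr -scalemxAl -!map_mxM.
have -> : \det Z = \det T.
  rewrite -eT !det_mulmx mulrC mulrA -det_mulmx -map_mxM mulVmx // map_mx1.
  by rewrite det1 mul1r.
rewrite det_trig; last first.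
  apply/is_trig_mxP => i j lt_ij; rewrite mxE summxE big1 ?addr0.
    by rewrite !mxE -val_eqE /= ltn_eqF // mulr0.
  move=> l _; have /is_trig_mxP/(_ i j lt_ij) e := At l.
  by rewrite mxE [X in _ * X]mxE e rmorph0 mulr0.
apply: eq_bigr => i _; rewrite /T mxE summxE; congr (_ + _).
  by rewrite !mxE eqxx mulr1.
by apply: eq_bigr => j _; rewrite mxE [X in _ * X = _]mxE.
Qed.

End Pencils.

(** Constant factors and leading coefficients collect into one scalar, which monicity forces to be
    1. *)
Lemma prod_affine_monic (F : fieldType) (I : Type) (s : seq I) (c b : I -> F) :
  \prod_(l <- s) ((c l)%:P + b l *: 'X) \is monic ->
  \prod_(l <- s) ((c l)%:P + b l *: 'X)
    = \prod_(l <- s | b l != 0) ('X - (- (c l / b l))%:P).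
Proof.
set p := \prod_(l <- s) _; set q := \prod_(l <- s | _) _.
suff [k ->] : exists k, p = k *: q.
  move=> /monicP; rewrite lead_coefZ lead_coef_prod_XsubC mulr1 => ->.
  by rewrite scale1r.
rewrite /p /q; elim: s {p q} => [|l s [k IH]].
  by exists 1; rewrite !big_nil scale1r.
rewrite !big_cons IH; have [b0|b0] /= := eqVneq (b l) 0.
  by exists (c l * k); rewrite b0 scale0r addr0 mul_polyC scalerA.
exists (b l * k); have -> : (c l)%:P + b l *: 'X = b l *: ('X - (- (c l / b l))%:P).
  rewrite polyCN opprK scalerDr addrC; congr (_ + _).
  by rewrite -mul_polyC -polyCM mulrCA divff ?mulr1.
by rewrite -scalerAr -scalerAl scalerA mulrC.
Qed.

Lemma mpoly_affineE (R : nzRingType) k (l : {mpoly R[k]}) : (msize l <= 2)%N ->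
  l = (l@_0)%:MP + \sum_i l@_(U_(i)) *: 'X_i.
Proof.
move=> l2; apply/mpolyP => w; rewrite mcoeffD mcoeffC raddf_sum /=.
under eq_bigr => i _ do rewrite mcoeffZ mcoeffX.
case: (ltnP (mdeg w) 2) => [w2|w2]; last first.
  rewrite memN_msupp_eq0; last exact: msize_mdeg_ge (leq_trans l2 w2).
  rewrite big1 => [|i _].
    by case: eqP w2 => [->|_ _]; rewrite ?mdeg0 // mulr0 addr0.
  by case: eqP w2 => [<-|_ _]; rewrite ?mdeg1 // mulr0.
have [w1|] := boolP (mdeg w == 1%N).
  have /mdeg1P[i /eqP ->] := w1.
  rewrite mnm1_eq0 mulr0 add0r (bigD1 i) //= eqxx mulr1 big1 ?addr0 // => j ji.
  by rewrite eq_mnm1 (negPf ji) mulr0.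
case: (posnP (mdeg w)) => [w0 _|w0 w1]; last first.
  by move: w1 w0 w2; case: (mdeg w) => [|[|]].
have -> : w = 0%MM by apply/eqP; rewrite -mdeg_eq0 w0.
rewrite eqxx mulr1 big1 ?addr0 // => i _.
by rewrite mnm1_eq0 mulr0.
Qed.

Lemma prod_linear_pencil_trig (F : fieldType) d m (M : 'I_m -> 'M[F]_d) (A : 'M[F]_d) :
  A \in unitmx -> (forall j, is_trig_mx (A *m M j *m invmx A)) ->
  exists s : seq {mpoly F[m.+1]}, all (fun l => msize l <= 2)%N s /\
    \det ('X_ord0 *: (1%:M : 'M[{mpoly F[m.+1]}]_d)
        + \sum_(i < m) 'X_(lift ord0 i) *: map_mx (fun c : F => c%:MP) (M i))
    = \prod_(l <- s) l.
Proof.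
move=> Au At.
pose g i : {mpoly F[m.+1]} :=
  'X_ord0 + \sum_j 'X_(lift ord0 j) * ((A *m M j *m invmx A) i i)%:MP.
exists [seq g i | i <- index_enum 'I_d]; split; last first.
  rewrite big_map; exact: (det_pencil_trig (@mpolyC m.+1 F) _ _ Au At).
apply/allP => _ /mapP[i _ ->].
have X2 j : (msize ('X_j : {mpoly F[m.+1]}) <= 2)%N by rewrite msizeX mdeg1.
apply: leq_trans (msizeD_le _ _) _; rewrite geq_max X2 /=.
apply: leq_trans (msize_sum _ _ _) _; apply/bigmax_leqP => j _.
by rewrite mulrC mul_mpolyC; apply: leq_trans (msizeZ_le _ _) (X2 _).
Qed.

Lemma mmap_affine (F : fieldType) m (l : {mpoly F[m.+1]}) (u : 'I_m -> F) :
  (msize l <= 2)%N ->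
  mmap (@polyC F) (fun i => if unlift ord0 i is Some j then (- u j)%:P else 'X) l
  = (l@_0 - \sum_j l@_(U_(lift ord0 j)) * u j)%:P + l@_(U_(ord0)) *: 'X.
Proof.
move=> /mpoly_affineE {1}->; rewrite raddfD raddf_sum /= mmapC big_ord_recl.
rewrite mmapZ mmapX mmap1U unlift_none mul_polyC addrCA addrC polyCB; congr (_ + _ + _).
rewrite (raddf_sum (@polyC F)) /= -sumrN; apply: eq_bigr => j _.
by rewrite mmapZ mmapX mmap1U liftK -polyCM mulrN polyCN.
Qed.

(** Substituting z_0 = X and z_i = - u_i turns the pencil into the characteristic matrix of the
    combination. *)
Lemma mmap_pencil (F : fieldType) d m (M : 'I_m -> 'M[F]_d) (u : 'I_m -> F) :
  mmap (@polyC F) (fun i => if unlift ord0 i is Some j then (- u j)%:P else 'X)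
    (\det ('X_ord0 *: (1%:M : 'M[{mpoly F[m.+1]}]_d)
        + \sum_(i < m) 'X_(lift ord0 i) *: map_mx (fun c : F => c%:MP) (M i)))
  = char_poly (\sum_i u i *: M i).
Proof.
set h := fun i => _.
have mmapM p q : mmap (@polyC F) h (p * q) = mmap (@polyC F) h p * mmap (@polyC F) h q.
  exact: rmorphM.
rewrite -det_map_mx; congr (\det _); apply/matrixP => i j.
rewrite !mxE !summxE raddfD /=; congr (_ + _).
  rewrite mmapM mmapX mmap1U /h unlift_none -[RHS]mulr_natr; congr (_ * _).
  by rewrite -mpolyC_nat mmapC; exact: polyC_natr.
rewrite raddf_sum (raddf_sum (@polyC F)) -sumrN; apply: eq_bigr => l _ /=.
by rewrite !mxE mmapM mmapX mmap1U /h liftK mmapC -polyCM mulNr polyCN.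
Qed.

Lemma char_poly0 (R : comNzRingType) d : char_poly (0 : 'M[R]_d) = 'X^d.
Proof. by rewrite /char_poly /char_poly_mx map_mx0 subr0 det_scalar. Qed.

(** Under the substitution of [mmap_pencil] the linear factors become affine in X, and those that
    involve X have roots affine in x. Listing the factors in [r] keeps multiplicities. *)
Lemma char_poly_mv_weights n d m (P : 'M[C]_n) (psi : 'rV[C]_n -> 'M[C]_d)
    (v : 'I_m -> 'rV[C]_n) :
  linear_on P psi -> is_basis P v -> prod_linear_factors (char_poly_mv psi v) ->
  exists (r : seq {mpoly C[m.+1]}) (lam : {mpoly C[m.+1]} -> 'rV[C]_n -> C),
    (forall l, linear_on P (lam l : _ -> C^o)) /\
    forall x, (x <= P)%MS -> char_poly (psi x) = \prod_(l <- r) ('X - (lam l x)%:P).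
Proof.
move=> pL [_ VP] [s [/allP s2 es]]; set V := \matrix_(i < m) v i in VP.
case/andP: VP => VP PV.
(* Pseudo-inversion reads off coordinates in the basis [v]. *)
pose g (l : {mpoly C[m.+1]}) (x : 'rV[C]_n) : C :=
  \sum_j l@_(U_(lift ord0 j)) * (x *m pinvmx V) 0 j.
have gL l : linear_on P (g l : _ -> C^o).
  move=> a x y _ _; rewrite /g mulmxDl -scalemxAl scaler_sumr -big_split.
  by apply: eq_bigr => j _; rewrite !mxE mulrDr mulrCA.
pose b (l : {mpoly C[m.+1]}) : C := l@_(U_(ord0)).
have cp x : (x <= P)%MS -> char_poly (psi x) =
    \prod_(l <- s | b l != 0) ('X - (- ((l@_0 - g l x) / b l))%:P).
  move=> xP; have e : char_poly (psi x) = \prod_(l <- s) ((l@_0 - g l x)%:P + b l *: 'X).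
    pose u i := (x *m pinvmx V) 0 i.
    have -> : psi x = \sum_i u i *: psi (v i).
      rewrite -{1}(mulmxKpV (submx_trans xP PV)).
      rewrite (linear_on_mulmx _ (linear_onS VP pL)).
      by apply: eq_bigr => i _; rewrite rowK.
    rewrite -mmap_pencil -[\det _]/(char_poly_mv psi v) es.
    set h := fun i => _.
    rewrite (big_morph (mmap (@polyC C) h) (rmorphM _) (rmorph1 _)).
    by rewrite !big_seq; apply: eq_bigr => l ls; rewrite mmap_affine ?s2.
  by have := char_poly_monic (psi x); rewrite e => /prod_affine_monic.
(* At x = 0 the characteristic polynomial is X^d, so every root, and with it the constant term of
   every factor involving X, vanishes. *)
have l0 l : l \in s -> b l != 0 -> l@_0 = 0.
  move=> ls bl; have := cp 0 (sub0mx _ _); rewrite (linear_on0 pL) (char_poly0 C d).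
  move=> /(congr1 (fun p : {poly C} => p.[- ((l@_0 - g l 0) / b l)])).
  rewrite (big_rem l) //= bl hornerM !hornerE subrr mul0r => /eqP.
  rewrite expf_eq0 => /andP[_]; rewrite oppr_eq0 mulf_eq0 invr_eq0 (negPf bl) orbF.
  by rewrite (linear_on0 (gL l)) subr0 => /eqP.
exists [seq l <- s | b l != 0], (fun l x => g l x / b l); split.
  by move=> l a x y xP yP; rewrite gL // mulrDl -mulrA.
move=> x xP; rewrite (cp x xP) big_filter [LHS]big_seq_cond [RHS]big_seq_cond.
apply: eq_bigr => l /andP[ls bl]; congr ('X - _%:P).
by rewrite (l0 l ls bl) sub0r mulNr opprK.
Qed.

(** * Solvability from nilpotent adjoint action *)

(** Acting on rows from the right, a strictly lower triangular matrix sends the span of the first i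
    + 1 unit vectors into the span of the first i; the trailing [pid_mx i] records this. *)
Lemma pid_mul_strict_trig (R : nzRingType) n i (T : 'M[R]_n) :
  (forall r c : 'I_n, (r <= c)%N -> T r c = 0) ->
  (pid_mx i.+1 : 'M[R]_n) *m T = pid_mx i.+1 *m T *m (pid_mx i : 'M[R]_n).
Proof.
move=> T0; apply/matrixP => r c; rewrite [RHS]mxE (bigD1 c) //= [X in _ + X]big1.
  rewrite addr0 [pid_mx i c c]mxE eqxx /=; case: ltnP => [_|ic]; first by rewrite mulr1.
  rewrite mulr0 mxE big1 // => l _; rewrite mxE; case: eqVneq => [/val_inj <-|_].
    by case: ltnP => ri; rewrite ?mul0r // T0 ?mulr0 // (leq_trans _ ic).
  by rewrite mul0r.
by move=> l lc; rewrite [pid_mx i l c]mxE val_eqE (negPf lc) mulr0.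
Qed.

Section Adjoint.
Variables (n : nat) (br : 'rV[C]_n -> 'rV[C]_n -> 'rV[C]_n).
Hypothesis hlie : is_lie_bracket br.

(* Acting on row vectors from the right, y |-> [y, x] represents x
   without the sign of the left adjoint action. *)
Definition ad_mx (x : 'rV[C]_n) : 'M[C]_n := \matrix_i br (delta_mx 0 i) x.

Lemma mul_ad_mx x y : y *m ad_mx x = br y x.
Proof.
rewrite -{2}[y]mulmx1 (linear_on_mulmx _ (br_linear_l hlie (K := 1%:M) x)).
by rewrite mulmx_sum_row; apply: eq_bigr => i _; rewrite rowK row1.
Qed.

(** With the right action, x acts before y in [ad_mx x *m ad_mx y], and Jacobi reads [z, [x, y]] =
    [[z, x], y] - [[z, y], x]. *)
Lemma ad_mx_rep P : is_rep br P ad_mx.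
Proof.
have eqR (M N : 'M[C]_n) : (forall y : 'rV_n, y *m M = y *m N) -> M = N.
  by move=> e; apply/row_matrixP => i; rewrite !rowE e.
case: hlie => brl brr _ jac; split=> [a x y _ _|x y _ _]; apply: eqR => z.
  by rewrite mulmxDr -scalemxAr !mul_ad_mx brr.
rewrite mulmxBr !mulmxA !mul_ad_mx.
have brN u w : br (- u) w = - br u w.
  by rewrite -scaleN1r (linear_onZ _ (br_linear_l hlie (K := 1%:M) w)) ?submx1 ?scaleN1r.
have := jac z x y; rewrite (brC hlie x (br y z)) (brC hlie y (br z x)) (brC hlie y z).
by rewrite brN opprK => /eqP; rewrite subr_eq0 eq_sym -subr_eq => /eqP.
Qed.

(** Since [y, y] = 0, brackets in [K + y] land in [K] itself, which makes [K + y] a subalgebra with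
    derived algebra in [K]. *)
Lemma br_adjoin (K : 'M[C]_n) y :
  subalgebra br K -> (forall x, (x <= K)%MS -> (br y x <= K)%MS) ->
  forall x z, (x <= K + y)%MS -> (z <= K + y)%MS -> (br x z <= K)%MS.
Proof.
move=> Ksub yK _ _ /sub_addsmxP[[u1 u2] /= ->] /sub_addsmxP[[w1 w2] /= ->].
rewrite [u2]mx11_scalar [w2]mx11_scalar !mul_scalar_mx.
have u1K := submxMl u1 K; have w1K := submxMl w1 K.
move: (u1 *m K) (w1 *m K) (u2 0 0) (w2 0 0) u1K w1K => k1 k2 c1 c2 k1K k2K.
have Ky : (br k1 y <= K)%MS by rewrite brC // eqmx_opp yK.
case: hlie => brl brr brxx _; rewrite ![k1 + _]addrC ![k2 + _]addrC brl !brr brxx.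
rewrite scaler0 add0r; apply: addmx_sub; first exact/scalemx_sub/yK.
by apply: addmx_sub; [exact: scalemx_sub | exact: Ksub].
Qed.

(* The operators ad x, x in K, are strictly triangular along a flag; the first
   step of the flag that meets D outside K provides the new element. *)
Lemma nilpotent_normalizer (D K : 'M[C]_n) : subalgebra br D ->
  (forall x, (x <= D)%MS -> char_poly (ad_mx x) = 'X^n) ->
  subalgebra br K -> solvable_sub br K -> (K <= D)%MS -> ~~ (D <= K)%MS ->
  exists y : 'rV[C]_n,
    [/\ (y <= D)%MS, ~~ (y <= K)%MS & forall x, (x <= K)%MS -> (br y x <= K)%MS].
Proof.
move=> Dsub Dnil Ksub Ksol KD DK.
have [A Au At] := triangularizable_solvable hlie Ksub Ksol (ad_mx_rep K).
pose T x := A *m ad_mx x *m invmx A.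
(* A triangular matrix with characteristic polynomial X^n has zero diagonal. *)
have T0 x (i j : 'I_n) : (x <= K)%MS -> (i <= j)%N -> T x i j = 0.
  move=> xK; have Tt := At x xK; rewrite leq_eqVlt => /predU1P[/val_inj <-|]; last first.
    by move/is_trig_mxP: Tt; apply.
  have := Dnil x (submx_trans xK KD); rewrite -(char_poly_conj _ Au) -/(T x).
  rewrite (char_poly_trig Tt) => /(congr1 (fun p : {poly C} => p.[T x i i])).
  rewrite horner_prod (bigD1 i) //= !hornerE subrr mul0r => /esym/eqP.
  by rewrite expf_eq0 => /andP[_ /eqP].
(* [Fl i] is the span of the first [i] rows of [A]; ad x lowers it by one step. *)
pose Fl i : 'M[C]_n := pid_mx i *m A.
have FlK x i : (x <= K)%MS -> (Fl i.+1 *m ad_mx x <= Fl i)%MS.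
  move=> xK; have -> : Fl i.+1 *m ad_mx x = pid_mx i.+1 *m T x *m A.
    by rewrite /Fl /T !mulmxA mulmxKV.
  rewrite (pid_mul_strict_trig i (T := T x)); last by move=> r c; apply: T0.
  by rewrite -[_ *m pid_mx i *m A]mulmxA submxMl.
have ex : exists i, ~~ (Fl i :&: D <= K)%MS.
  exists n; apply: contra DK; apply: submx_trans; rewrite sub_capmx submx_refl andbT.
  by rewrite /Fl pid_mx_1 mul1mx; apply: submx_full; rewrite row_full_unit.
case: (ex_minnP ex) => -[|i] nK min.
  by case/negP: nK; rewrite /Fl pid_mx_0 mul0mx cap0mx sub0mx.
have FK : (Fl i :&: D <= K)%MS.
  by apply/negPn/negP => /min; rewrite ltnn.
have /row_subPn[j yK] := nK; set y := row j _ in yK.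
have : (y <= Fl i.+1 :&: D)%MS by apply: row_sub.
rewrite sub_capmx => /andP[yF yD]; exists y; split=> // x xK.
(* [y, x] lies in [D] and one step lower in the flag, hence in [K] by minimality. *)
apply: submx_trans FK; rewrite sub_capmx Dsub // ?(submx_trans xK) // andbT.
by rewrite -mul_ad_mx; apply: submx_trans (FlK x i xK); apply: submxMr.
Qed.

(** Starting from zero, normalizing elements are adjoined until the rank of [D] is reached; each
    extension has its derived algebra in the previous solvable one. *)
Lemma solvable_nilpotent (D : 'M[C]_n) : subalgebra br D ->
  (forall x, (x <= D)%MS -> char_poly (ad_mx x) = 'X^n) -> solvable_sub br D.
Proof.
move=> Dsub Dnil.
have [K [Ksub Ksol KD rK]] : exists K : 'M[C]_n,
    [/\ subalgebra br K, solvable_sub br K, (K <= D)%MS & (\rank D <= \rank K)%N].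
  elim: {-2}(\rank D) (leqnn (\rank D)) => [_|k IH kD].
    exists 0; split; rewrite ?sub0mx //; last by exists 0%N; rewrite /= submx_refl.
    move=> x y; rewrite submx0 => /eqP -> _.
    by rewrite (linear_on0 (br_linear_l hlie (K := 1%:M) y)) sub0mx.
  have [K [Ksub Ksol KD kK]] := IH (ltnW kD).
  have [DK|DK] := boolP (D <= K)%MS.
    by exists K; split=> //; apply: leq_trans kD (mxrankS DK).
  have [y [yD yK brK]] := nilpotent_normalizer Dsub Dnil Ksub Ksol KD DK.
  have brKy := br_adjoin Ksub brK; exists (K + y)%MS; split.
  - by move=> x z xK zK; apply: submx_trans (brKy _ _ xK zK) (addsmxSl _ _).
  - by apply: solvable_derived; apply: solvable_subS Ksol => //; apply: derived_sub.
  - by rewrite addsmx_sub KD.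
  apply: leq_ltn_trans kK _; apply: rank_ltmx; rewrite ltmxE addsmxSl /=.
  by apply: contra yK; apply: submx_trans; apply: addsmxSr.
apply: solvable_subS Ksol => //.
by rewrite -(mxrank_leqif_sup KD) eqn_leq rK mxrankS.
Qed.

End Adjoint.

(** A kernel given as a row space lets vanishing on brackets pass to their span, the derived
    algebra. *)
Lemma linear_on_kernel (F : fieldType) m n (K : 'M[F]_(m, n)) (f : 'rV[F]_n -> F) :
  linear_on K (f : _ -> F^o) ->
  exists Z : 'M[F]_(m, n), forall x, (x <= Z)%MS <-> (x <= K)%MS /\ f x = 0.
Proof.
move=> fL; pose c : 'cV[F]_m := \col_j f (row j K).
have fE u : f (u *m K) = (u *m c) 0 0.
  by rewrite (linear_on_mulmx u fL) mxE; apply: eq_bigr => j _; rewrite mxE.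
exists (kermx c *m K) => x; split=> [/submxP[w ->]|[/submxP[u ->]]].
  by rewrite mulmxA submxMl fE -mulmxA mulmx_ker mulmx0 mxE.
rewrite fE => u0; apply: submxMr; apply/sub_kermxP/matrixP => i j.
by rewrite !ord1 u0 mxE.
Qed.

(** * The two implications *)

Lemma solvable_prod_linear n (br : 'rV[C]_n -> 'rV[C]_n -> 'rV[C]_n) (P : 'M[C]_n) :
  is_lie_bracket br -> subalgebra br P -> solvable_sub br P ->
  forall (d : nat) (psi : 'rV[C]_n -> 'M[C]_d), is_rep br P psi ->
  forall (m : nat) (v : 'I_m -> 'rV[C]_n), is_basis P v ->
  prod_linear_factors (char_poly_mv psi v).
Proof.
move=> hlie Psub Psol d psi psiR m v [_ /andP[vP _]].
have [A Au At] := triangularizable_solvable hlie Psub Psol psiR.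
apply: prod_linear_pencil_trig Au _ => j; apply: At.
by apply: submx_trans vP; rewrite -[v j](rowK v); apply: row_sub.
Qed.

Lemma prod_linear_solvable n (br : 'rV[C]_n -> 'rV[C]_n -> 'rV[C]_n) (P : 'M[C]_n) m
    (v : 'I_m -> 'rV[C]_n) :
  is_lie_bracket br -> subalgebra br P -> is_basis P v ->
  prod_linear_factors (char_poly_mv (ad_mx br) v) -> solvable_sub br P.
Proof.
move=> hlie Psub vb; have [adL adB] := ad_mx_rep hlie P.
case/(char_poly_mv_weights adL vb) => r [lam [lamL cp]].
have lam0 l a x : l \in r -> (a <= P)%MS -> (x <= P)%MS -> lam l (br a x) = 0.
  move=> lr aP xP; apply: (weight_derivation_eq0 (A := ad_mx br a) adL
    (br_linear_r hlie a) _ _ lamL cp lr) => // z zP; first exact: Psub.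
  exact: adB.
apply: solvable_derived; apply: solvable_nilpotent => //.
  exact: subalgebra_derived.
move=> x xD; have xP := submx_trans xD (derived_subalgebra Psub).
have lamD l : l \in r -> lam l x = 0.
  move=> lr; have [Z ZP] := linear_on_kernel (lamL l).
  suff /ZP[] : (x <= Z)%MS by [].
  apply: submx_trans xD _; apply: derived_sub => y z yP zP.
  by apply/ZP; rewrite lam0 ?Psub.
have e : char_poly (ad_mx br x) = 'X^(size r).
  rewrite cp // big_seq (eq_bigr (fun=> 'X)) => [|l lr]; last by rewrite lamD // subr0.
  by rewrite -big_seq big_const_seq count_predT iter_mulr_1.
(* Comparing degrees identifies [size r] with [n]. *)
by have := size_char_poly (ad_mx br x); rewrite e size_polyXn => -[->].
Qed.

Theorem theorem6p4 (n : nat) (br : 'rV[C]_n -> 'rV[C]_n -> 'rV[C]_n)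
  (hlie : is_lie_bracket br) (hsimple : simple_lie br)
  (P : 'M[C]_n) (hP : parabolic br P) :
  borel br P <->
  (forall (d : nat) (psi : 'rV[C]_n -> 'M[C]_d), is_rep br P psi ->
   forall (m : nat) (v : 'I_m -> 'rV[C]_n), is_basis P v ->
   prod_linear_factors (char_poly_mv psi v)).
Proof.
case: hP => Psub [B [[_ _ Bmax] BP]]; split=> [[_ Psol _]|H].
  exact: solvable_prod_linear.
(* The hypothesis is applied to the adjoint action in the basis of rows of [row_base P]. *)
have vb : is_basis P (fun i => row i (row_base P)).
  rewrite /is_basis; set V := \matrix_i _.
  have -> : V = row_base P by apply/row_matrixP => i; rewrite rowK.
  by rewrite row_base_free; split=> //; apply/eqmxP/eq_row_base.
have Psol := prod_linear_solvable hlie Psub vb (H _ _ (ad_mx_rep hlie P) _ _ vb).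
(* A solvable subalgebra [T] containing [P] contains [B], so maximality of [B] gives T <= B <= P. *)
split=> // T Tsub Tsol PT.
exact: submx_trans (Bmax T Tsub Tsol (submx_trans BP PT)) BP.
Qed.
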